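(* Let $\psi$ be an analytic function on $\mathbb{D}$ that is the symbol of a bounded multiplication operator $M_\psi$ on the Bloch space $\mathcal{B}$. Then $\sigma(M_\psi) = \overline{\psi(\mathbb{D})}$.
   Context: $\mathbb{D}$ is the open unit disk in $\mathbb{C}$. For $f$ analytic on $\mathbb{D}$, put $\beta_f = \sup_{z\in\mathbb{D}} (1-|z|^2)|f'(z)|$. The Bloch space $\mathcal{B}$ is the complex Banach space of analytic functions $f$ on $\mathbb{D}$ with $\beta_f<\infty$, with norm $\|f\|_{\mathcal{B}} = |f(0)|+\beta_f$. The multiplication operator with symbol $\psi$ is $M_\psi(f)=\psi f$; it is bounded on $\mathcal{B}$ if it is a bounded linear operator from $\mathcal{B}$ to $\mathcal{B}$. $\sigma(T)=\{\lambda\in\mathbb{C}: T-\lambda I \text{ is not invertible}\}$ denotes the spectrum of a bounded operator $T$ on $\mathcal{B}$, and the overline denotes closure in $\mathbb{C}$. *)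

(* Defs.v *)
From Stdlib Require Import Reals Lra.
From Stdlib Require Import FunctionalExtensionality ProofIrrelevance.
From Coquelicot Require Export Coquelicot.

(** In Coquelicot, [is_linear T] says that [T] is linear and that
    [norm (T x) <= M * norm x] for some constant [M]: it is the predicate
    "bounded linear operator".  Invertibility is invertibility in the algebra of
    bounded operators, i.e. existence of a bounded two-sided inverse. *)
Definition invertible_op {V : NormedModule C_AbsRing} (T : V -> V) : Prop :=
  exists S : V -> V,
    is_linear S /\ (forall x, S (T x) = x) /\ (forall x, T (S x) = x).

Definition spectrum {V : NormedModule C_AbsRing} (T : V -> V) (lambda : C) : Prop :=
  ~ invertible_op (fun x : V => minus (T x) (scal (lambda : C_AbsRing) x)).

Definition closure {T : UniformSpace} (A : T -> Prop) (x : T) : Prop :=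
  forall P : T -> Prop, locally x P -> exists y, P y /\ A y.

(** Functions on the disk are represented by total functions [C -> C]; all
    notions below only look at their values at points of the disk, which is open,
    so that the (complex) derivatives do not see the values outside either. *)

Definition unit_disk (z : C) : Prop := Cmod z < 1.

Definition analytic_on_disk (f : C -> C) : Prop :=
  forall z : C, unit_disk z -> ex_derive f z.

Definition disk_image (f : C -> C) (w : C) : Prop :=
  exists z : C, unit_disk z /\ f z = w.

(** [C_derive f z] is the complex derivative as soon as [f] is differentiable at
    [z]; it is only used below for functions analytic on the disk. *)
Definition bloch_values (f : C -> C) (x : R) : Prop :=
  exists z : C, unit_disk z /\ x = (1 - Cmod z ^ 2) * Cmod (C_derive f z).

Definition bloch_seminorm (f : C -> C) : Rbar := Lub_Rbar (bloch_values f).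

Definition is_bloch (f : C -> C) : Prop :=
  analytic_on_disk f /\ Rbar_lt (bloch_seminorm f) p_infty.

Lemma is_bloch_intro (f : C -> C) (M : R) :
  analytic_on_disk f ->
  (forall z, unit_disk z -> (1 - Cmod z ^ 2) * Cmod (C_derive f z) <= M) ->
  is_bloch f /\ real (bloch_seminorm f) <= M.
Proof.
  intros Hf HM. unfold is_bloch, bloch_seminorm.
  destruct (Lub_Rbar_correct (bloch_values f)) as [Hub Hlub].
  assert (H : Rbar_le (Lub_Rbar (bloch_values f)) M).
  { apply Hlub. intros x (z & Hz & ->). now apply HM. }
  assert (H0 : bloch_values f ((1 - Cmod 0 ^ 2) * Cmod (C_derive f 0))).
  { exists (RtoC 0). split; [|reflexivity].
    unfold unit_disk. rewrite Cmod_0. lra. }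
  apply Hub in H0.
  destruct (Lub_Rbar (bloch_values f)); simpl in *; tauto.
Qed.

Lemma bloch_seminorm_ub (f : C -> C) :
  is_bloch f -> forall z, unit_disk z ->
  (1 - Cmod z ^ 2) * Cmod (C_derive f z) <= real (bloch_seminorm f).
Proof.
  intros [_ Hf] z Hz. unfold bloch_seminorm in *.
  destruct (Lub_Rbar_correct (bloch_values f)) as [Hub _].
  assert (H0 : bloch_values f ((1 - Cmod z ^ 2) * Cmod (C_derive f z))).
  { now exists z. }
  apply Hub in H0.
  destruct (Lub_Rbar (bloch_values f)); simpl in *; tauto.
Qed.

Lemma unit_disk_weight (z : C) : unit_disk z -> 0 < 1 - Cmod z ^ 2.
Proof.
  unfold unit_disk. intros Hz. pose proof (Cmod_ge_0 z). nra.
Qed.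

Lemma unit_disk_0 : unit_disk 0.
Proof. unfold unit_disk. rewrite Cmod_0. lra. Qed.

Lemma bloch_seminorm_ge_0 (f : C -> C) :
  is_bloch f -> 0 <= real (bloch_seminorm f).
Proof.
  intros Hf. eapply Rle_trans; [|apply (bloch_seminorm_ub f Hf 0 unit_disk_0)].
  apply Rmult_le_pos; [|apply Cmod_ge_0].
  apply Rlt_le, unit_disk_weight, unit_disk_0.
Qed.

Lemma C_derive_plus (f g : C -> C) (z : C) :
  ex_derive f z -> ex_derive g z ->
  ex_derive (fun x => (f x + g x)%C) z /\
  C_derive (fun x => (f x + g x)%C) z = (C_derive f z + C_derive g z)%C.
Proof.
  intros Hf Hg.
  apply (C_derive_correct f z z) in Hf. apply (C_derive_correct g z z) in Hg.
  assert (H := is_derive_plus f g z _ _ Hf Hg).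
  split; [eexists; exact H | now apply is_C_derive_unique].
Qed.

Lemma C_derive_scal (k : C) (f : C -> C) (z : C) :
  ex_derive f z ->
  ex_derive (fun x => (k * f x)%C) z /\
  C_derive (fun x => (k * f x)%C) z = (k * C_derive f z)%C.
Proof.
  intros Hf. apply (C_derive_correct f z z) in Hf.
  assert (H : is_derive (fun x => (k * f x)%C) z (k * C_derive f z)%C).
  { eapply filterdiff_ext_lin.
    - apply (@filterdiff_scal_r_fct C_AbsRing (AbsRing_NormedModule C_AbsRing)
               C_NormedModule _ _ k f _ Cmult_comm Hf).
    - intros y. change (k * (y * C_derive f z) = y * (k * C_derive f z))%C. ring. }
  split; [eexists; exact H | now apply is_C_derive_unique].
Qed.

Lemma is_bloch_plus (f g : C -> C) :
  is_bloch f -> is_bloch g ->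
  is_bloch (fun z => (f z + g z)%C) /\
  real (bloch_seminorm (fun z => (f z + g z)%C)) <=
  real (bloch_seminorm f) + real (bloch_seminorm g).
Proof.
  intros Hf Hg. apply is_bloch_intro.
  - intros z Hz. apply C_derive_plus; [apply Hf | apply Hg]; exact Hz.
  - intros z Hz.
    destruct (C_derive_plus f g z) as [_ ->]; [now apply Hf | now apply Hg |].
    pose proof (unit_disk_weight z Hz).
    pose proof (bloch_seminorm_ub f Hf z Hz).
    pose proof (bloch_seminorm_ub g Hg z Hz).
    pose proof (Cmod_triangle (C_derive f z) (C_derive g z)).
    nra.
Qed.

Lemma is_bloch_scal (k : C) (f : C -> C) :
  is_bloch f ->
  is_bloch (fun z => (k * f z)%C) /\
  real (bloch_seminorm (fun z => (k * f z)%C)) <=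
  Cmod k * real (bloch_seminorm f).
Proof.
  intros Hf. apply is_bloch_intro.
  - intros z Hz. apply C_derive_scal. now apply Hf.
  - intros z Hz.
    destruct (C_derive_scal k f z) as [_ ->]; [now apply Hf |].
    rewrite Cmod_mult.
    pose proof (bloch_seminorm_ub f Hf z Hz). pose proof (Cmod_ge_0 k).
    replace ((1 - Cmod z ^ 2) * (Cmod k * Cmod (C_derive f z)))
      with (Cmod k * ((1 - Cmod z ^ 2) * Cmod (C_derive f z))) by ring.
    now apply Rmult_le_compat_l.
Qed.

Lemma is_bloch_zero : is_bloch (fun _ => 0%C).
Proof.
  assert (H : forall z : C, is_derive (V := C_NormedModule) (fun _ : C => RtoC 0) z (RtoC 0)).
  { intros z. apply (@is_derive_const C_AbsRing C_NormedModule). }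
  apply (is_bloch_intro _ 0).
  - intros z _. eexists. apply H.
  - intros z _. rewrite (is_C_derive_unique _ _ _ (H z)), Cmod_0. lra.
Qed.

(** An analytic function on the disk is represented by its extension by zero, so
    that equality of elements of [Bloch] is equality on the disk. *)
Record Bloch : Type := mkBloch {
  bloch_fun :> C -> C;
  bloch_outside : forall z, ~ unit_disk z -> bloch_fun z = 0%C;
  bloch_is_bloch : is_bloch bloch_fun
}.

Definition bloch_norm (f : Bloch) : R :=
  Cmod (f 0%C) + real (bloch_seminorm f).

Lemma Bloch_eq (f g : Bloch) : (forall z, f z = g z) -> f = g.
Proof.
  destruct f as [f Hf1 Hf2], g as [g Hg1 Hg2]; simpl; intros H.
  apply functional_extensionality in H. subst g.
  f_equal; apply proof_irrelevance.
Qed.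

Lemma bloch_plus_outside (f g : Bloch) z :
  ~ unit_disk z -> (f z + g z)%C = 0%C.
Proof. intros Hz. rewrite !bloch_outside by exact Hz. ring. Qed.

Lemma bloch_mult_outside (k : C) (f : Bloch) z :
  ~ unit_disk z -> (k * f z)%C = 0%C.
Proof. intros Hz. rewrite bloch_outside by exact Hz. ring. Qed.

Definition bloch_plus (f g : Bloch) : Bloch :=
  mkBloch (fun z => (f z + g z)%C) (bloch_plus_outside f g)
    (proj1 (is_bloch_plus f g (bloch_is_bloch f) (bloch_is_bloch g))).

Definition bloch_scal (k : C) (f : Bloch) : Bloch :=
  mkBloch (fun z => (k * f z)%C) (bloch_mult_outside k f)
    (proj1 (is_bloch_scal k f (bloch_is_bloch f))).

Definition bloch_opp (f : Bloch) : Bloch := bloch_scal (-(1))%C f.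

Definition bloch_zero : Bloch :=
  mkBloch (fun _ => 0%C) (fun _ _ => eq_refl) is_bloch_zero.

Definition Bloch_AbelianMonoid_mixin : AbelianMonoid.mixin_of Bloch.
Proof.
  apply (AbelianMonoid.Mixin Bloch bloch_plus bloch_zero);
    intros; apply Bloch_eq; intros; simpl; ring.
Defined.

Canonical Bloch_AbelianMonoid :=
  AbelianMonoid.Pack Bloch Bloch_AbelianMonoid_mixin Bloch.

Definition Bloch_AbelianGroup_mixin : AbelianGroup.mixin_of Bloch_AbelianMonoid.
Proof.
  apply (AbelianGroup.Mixin Bloch_AbelianMonoid bloch_opp).
  intros; apply Bloch_eq; intros; simpl; ring.
Defined.

Canonical Bloch_AbelianGroup :=
  AbelianGroup.Pack Bloch
    (AbelianGroup.Class _ Bloch_AbelianMonoid_mixin Bloch_AbelianGroup_mixin) Bloch.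

Definition Bloch_ModuleSpace_mixin :
  ModuleSpace.mixin_of C_AbsRing Bloch_AbelianGroup.
Proof.
  apply (ModuleSpace.Mixin C_AbsRing Bloch_AbelianGroup bloch_scal);
    intros; apply Bloch_eq; intros z; simpl.
  - exact (Cmult_assoc x y (u z)).
  - exact (Cmult_1_l (u z)).
  - exact (Cmult_plus_distr_l x (u z) (v z)).
  - exact (Cmult_plus_distr_r x y (u z)).
Defined.

Canonical Bloch_ModuleSpace :=
  ModuleSpace.Pack C_AbsRing Bloch
    (ModuleSpace.Class C_AbsRing _ (AbelianGroup.class Bloch_AbelianGroup)
       Bloch_ModuleSpace_mixin) Bloch.

Lemma bloch_norm_plus (f g : Bloch) :
  bloch_norm (plus f g) <= bloch_norm f + bloch_norm g.
Proof.
  unfold bloch_norm. simpl.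
  pose proof (proj2 (is_bloch_plus f g (bloch_is_bloch f) (bloch_is_bloch g))).
  pose proof (Cmod_triangle (f 0%C) (g 0%C)). simpl in *. lra.
Qed.

Lemma bloch_norm_scal (k : C) (f : Bloch) :
  bloch_norm (scal (k : C_AbsRing) f) <= Cmod k * bloch_norm f.
Proof.
  unfold bloch_norm. simpl.
  pose proof (proj2 (is_bloch_scal k f (bloch_is_bloch f))).
  rewrite Cmod_mult. simpl in *. lra.
Qed.

Lemma bloch_norm_opp (f : Bloch) : bloch_norm (opp f) <= bloch_norm f.
Proof.
  change (opp f) with (scal ((-(1))%C : C_AbsRing) f).
  eapply Rle_trans; [apply bloch_norm_scal|].
  rewrite Cmod_opp, Cmod_1. lra.
Qed.

Lemma bloch_norm_zero : bloch_norm bloch_zero = 0.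
Proof.
  pose proof (bloch_norm_scal 0%C bloch_zero) as H.
  replace (scal _ _) with bloch_zero in H
    by (apply Bloch_eq; intros z; simpl; ring).
  rewrite Cmod_0 in H.
  apply Rle_antisym; [lra|]. unfold bloch_norm.
  apply Rplus_le_le_0_compat; [apply Cmod_ge_0|].
  apply bloch_seminorm_ge_0, bloch_is_bloch.
Qed.

Lemma is_derive_Re_ray (f : C -> C) (z d : C) (t : R) :
  is_derive (V := C_NormedModule) f (RtoC t * z)%C d ->
  is_derive (fun s : R => Re (f (RtoC s * z)%C)) t (Re (d * z)%C).
Proof.
  intros [_ Hf]. apply is_derive_Reals. intros eps Heps.
  specialize (Hf _ (fun P HP => HP)).
  pose proof (Cmod_ge_0 z) as Hz.
  assert (He : 0 < eps / 2 / (Cmod z + 1)).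
  { apply Rdiv_lt_0_compat; lra. }
  destruct (Hf (mkposreal _ He)) as [del Hdel]. clear Hf. simpl in Hdel.
  assert (Hd : 0 < del / (Cmod z + 1)).
  { apply Rdiv_lt_0_compat; [apply cond_pos | lra]. }
  exists (mkposreal _ Hd). intros h Hh0 Hh. simpl in Hh.
  specialize (Hdel (RtoC (t + h) * z)%C).
  assert (E : (RtoC (t + h) * z - RtoC t * z)%C = (RtoC h * z)%C).
  { rewrite RtoC_plus. ring. }
  assert (Hball : Cmod (RtoC (t + h) * z - RtoC t * z)%C < del).
  { rewrite E, Cmod_mult, Cmod_R.
    apply (Rmult_lt_compat_r (Cmod z + 1)) in Hh; [|lra].
    unfold Rdiv in Hh. rewrite Rmult_assoc, Rinv_l, Rmult_1_r in Hh by lra.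
    pose proof (Rabs_pos h). nra. }
  specialize (Hdel Hball).
  change (Cmod ((f (RtoC (t + h) * z)%C - f (RtoC t * z)%C)
                - (RtoC (t + h) * z - RtoC t * z) * d)%C
          <= eps / 2 / (Cmod z + 1)
             * Cmod (RtoC (t + h) * z - RtoC t * z)%C) in Hdel.
  rewrite E, Cmod_mult, Cmod_R in Hdel.
  set (w := ((f (RtoC (t + h) * z)%C - f (RtoC t * z)%C)
             - RtoC h * z * d)%C) in *.
  assert (HRe : Re (f (RtoC (t + h) * z)%C) - Re (f (RtoC t * z)%C)
                = Re w + h * Re (d * z)%C).
  { unfold w, Re. simpl. ring. }
  rewrite HRe.
  replace ((Re w + h * Re (d * z)%C) / h - Re (d * z)%C) with (Re w / h)
    by (field; exact Hh0).
  unfold Rdiv. rewrite Rabs_mult, Rabs_inv.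
  pose proof (Rabs_pos_lt h Hh0) as Hah.
  apply (Rmult_lt_reg_r (Rabs h)); [exact Hah|].
  rewrite Rmult_assoc, Rinv_l, Rmult_1_r by lra.
  assert (HRw : Rabs (Re w) <= Cmod w).
  { eapply Rle_trans; [apply Rmax_l | apply Rmax_Cmod]. }
  assert (Hq : eps / 2 / (Cmod z + 1) * Cmod z <= eps / 2).
  { set (q := eps / 2 / (Cmod z + 1)) in *.
    replace (eps / 2) with (q * (Cmod z + 1)) by (unfold q; field; lra).
    nra. }
  nra.
Qed.

Lemma derive_zero_constant (f : C -> C) (z : C) :
  unit_disk z ->
  (forall w, unit_disk w -> is_derive (V := C_NormedModule) f w (RtoC 0)) ->
  f z = f 0%C.
Proof.
  intros Hz Hf.
  assert (Hray : forall t : R, 0 <= t <= 1 -> unit_disk (RtoC t * z)%C).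
  { intros t Ht. unfold unit_disk in *.
    rewrite Cmod_mult, Cmod_R, Rabs_pos_eq by lra.
    pose proof (Cmod_ge_0 z). nra. }
  assert (HRe : forall g : C -> C,
    (forall w, unit_disk w -> is_derive (V := C_NormedModule) g w (RtoC 0)) ->
    Re (g z) = Re (g 0%C)).
  { intros g Hg.
    rewrite <- (Cmult_1_l z) at 1. rewrite <- (Cmult_0_l z).
    symmetry.
    apply (eq_is_derive (fun s : R => Re (g (RtoC s * z)%C)) 0 1); [|lra].
    intros t Ht.
    replace (@zero R_NormedModule) with (Re (RtoC 0 * z)%C)
      by (unfold Re, zero; simpl; ring).
    apply is_derive_Re_ray, Hg, Hray, Ht. }
  assert (H1 := HRe f Hf).
  assert (H2 : Re (- Ci * f z)%C = Re (- Ci * f 0)%C).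
  { apply (HRe (fun w => - Ci * f w)%C). intros w Hw.
    destruct (C_derive_scal (- Ci)%C f w) as [He Hd].
    - eexists. now apply Hf.
    - rewrite (is_C_derive_unique _ _ _ (Hf w Hw)), Cmult_0_r in Hd.
      rewrite <- Hd. now apply C_derive_correct. }
  destruct (f z) as [a b], (f 0%C) as [a' b']. unfold Re in *. simpl in *.
  f_equal; lra.
Qed.

Lemma bloch_norm_eq_0 (f : Bloch) : bloch_norm f = 0 -> f = zero.
Proof.
  unfold bloch_norm. intros H.
  pose proof (Cmod_ge_0 (f 0%C)).
  pose proof (bloch_seminorm_ge_0 f (bloch_is_bloch f)).
  assert (Hf0 : f 0%C = 0%C) by (apply Cmod_eq_0; lra).
  apply Bloch_eq. intros z. change (f z = 0%C).
  destruct (Rlt_dec (Cmod z) 1) as [Hz|Hz].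
  - rewrite <- Hf0. apply derive_zero_constant; [exact Hz|]. intros w Hw.
    assert (Hd : C_derive f w = 0%C).
    { apply Cmod_eq_0.
      pose proof (bloch_seminorm_ub f (bloch_is_bloch f) w Hw).
      pose proof (unit_disk_weight w Hw).
      pose proof (Cmod_ge_0 (C_derive f w)). nra. }
    rewrite <- Hd. apply C_derive_correct; [exact w|].
    now apply (bloch_is_bloch f).
  - now apply bloch_outside.
Qed.

Definition bloch_ball (f : Bloch) (eps : R) (g : Bloch) : Prop :=
  bloch_norm (minus g f) < eps.

Definition Bloch_UniformSpace_mixin : UniformSpace.mixin_of Bloch.
Proof.
  apply (UniformSpace.Mixin Bloch bloch_zero bloch_ball); unfold bloch_ball.
  - intros f eps. rewrite minus_eq_zero.
    change (bloch_norm bloch_zero < eps). rewrite bloch_norm_zero. apply cond_pos.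
  - intros f g eps H. eapply Rle_lt_trans; [|exact H].
    rewrite <- (opp_minus g f). apply bloch_norm_opp.
  - intros f g h e1 e2 H1 H2.
    rewrite (minus_trans g).
    eapply Rle_lt_trans; [apply bloch_norm_plus|]. lra.
Defined.

Canonical Bloch_UniformSpace :=
  UniformSpace.Pack Bloch Bloch_UniformSpace_mixin Bloch.

Canonical Bloch_NormedModuleAux :=
  NormedModuleAux.Pack C_AbsRing Bloch
    (NormedModuleAux.Class C_AbsRing _ (ModuleSpace.class _ Bloch_ModuleSpace)
       Bloch_UniformSpace_mixin) Bloch.

Definition Bloch_NormedModule_mixin :
  NormedModule.mixin_of C_AbsRing Bloch_NormedModuleAux.
Proof.
  apply (NormedModule.Mixin C_AbsRing Bloch_NormedModuleAux bloch_norm 1).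
  - exact bloch_norm_plus.
  - exact bloch_norm_scal.
  - intros f g eps H. exact H.
  - intros f g eps H. rewrite Rmult_1_l. exact H.
  - exact bloch_norm_eq_0.
Defined.

Canonical Bloch_NormedModule :=
  NormedModule.Pack C_AbsRing Bloch
    (NormedModule.Class C_AbsRing _ (NormedModuleAux.class _ Bloch_NormedModuleAux)
       Bloch_NormedModule_mixin) Bloch.

Definition bloch_multiplier (psi : C -> C) : Prop :=
  forall f : C -> C, is_bloch f -> is_bloch (fun z => (psi z * f z)%C).

Lemma mult_op_outside (psi : C -> C) (f : Bloch) z :
  ~ unit_disk z -> (psi z * f z)%C = 0%C.
Proof. intros Hz. rewrite bloch_outside by exact Hz. ring. Qed.

Definition mult_op (psi : C -> C) (Hpsi : bloch_multiplier psi) (f : Bloch) : Bloch :=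
  mkBloch (fun z => (psi z * f z)%C) (mult_op_outside psi f)
    (Hpsi f (bloch_is_bloch f)).

(* Main.v *)
Require Import Defs.
From Stdlib Require Import Reals.
From Coquelicot Require Import Coquelicot.
From Stdlib Require Import Classical Lra.

(** By definition, [lambda] is outside the spectrum exactly when multiplication by
    [u = psi - lambda] is invertible, and [lambda] is outside the closure of the
    image exactly when [|u|] is bounded below on the disk by a positive constant.
    These two conditions on [u] are equivalent
    ([mult_invertible_iff_bounded_below]).

    If multiplication by [u] has a bounded inverse [S], then [S] is multiplication
    by [1/u].  Evaluation at a point [z] of the disk is a bounded functional on the
    Bloch space, nonzero because it does not kill the constant [1], and the adjoint
    of [S] multiplies it by [1 / u z].  An eigenvalue of the adjoint is at most the
    norm of [S] in modulus ([evaluation_eigenvalue_bound]), so [|u|] is bounded below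
    by [1 / norm S].

    Conversely, let [|u| >= c > 0] and let [f] be a Bloch function.  The quotient
    rule can be rewritten as
    [(f / u)' = 2 f' / u - (u f)' / u^2],
    in which [u'] occurs only through [(u f)'].  Both [f] and [u f] are Bloch
    functions, the latter with norm controlled by that of [f], so [f / u] is a Bloch
    function with norm controlled by that of [f] ([bloch_quotient]).  This is
    where the boundedness of multiplication by [u] enters. *)

(** * Complex derivatives *)

Lemma Cmod_le_minus_plus (a b : C) : Cmod a <= Cmod (a - b)%C + Cmod b.
Proof.
  replace a with (a - b + b)%C at 1 by ring. apply Cmod_triangle.
Qed.

(** [C] carries two normed modules over itself, as an absolute ring and as a plane.
    They share their operations and the norm [Cmod], and a derivative depends on the
    codomain through nothing else, so the two notions of derivative agree. *)
Lemma is_derive_C_AbsRing (f : C -> C) (z d : C) :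
  is_derive (V := C_NormedModule) f z d <->
  is_derive (V := AbsRing_NormedModule C_AbsRing) f z d.
Proof.
  split; intros [_ H]; (split; [|exact H]);
    [apply (@is_linear_scal_l C_AbsRing (AbsRing_NormedModule C_AbsRing))
    |apply (@is_linear_scal_l C_AbsRing C_NormedModule)].
Qed.

Lemma is_derive_C_mult (f g : C -> C) (z df dg : C) :
  is_derive (V := C_NormedModule) f z df ->
  is_derive (V := C_NormedModule) g z dg ->
  is_derive (V := C_NormedModule) (fun x => (f x * g x)%C) z
    (df * g z + f z * dg)%C.
Proof.
  rewrite !is_derive_C_AbsRing. intros Hf Hg.
  exact (@is_derive_mult C_AbsRing f g z df dg Hf Hg Cmult_comm).
Qed.

(** The remainder [1/w - 1/z + (w - z)/z^2] equals [(w - z)^2 / (w z^2)], and [|w|]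
    stays above [|z|/2] near [z]. *)
Lemma is_derive_Cinv (z : C) :
  z <> 0%C -> is_derive (V := C_NormedModule) Cinv z (- / (z * z))%C.
Proof.
  intros Hz. split.
  { apply (@is_linear_scal_l C_AbsRing C_NormedModule). }
  intros y Hy.
  apply (@is_filter_lim_locally_unique C_AbsRing (AbsRing_NormedModule C_AbsRing))
    in Hy.
  subst y. intros eps.
  assert (Hm := proj1 (Cmod_gt_0 z) Hz).
  assert (Hd : 0 < Rmin (Cmod z / 2) (eps * (Cmod z ^ 3 / 2))).
  { apply Rmin_glb_lt; [lra|].
    apply Rmult_lt_0_compat; [apply cond_pos|].
    pose proof (pow_lt _ 3 Hm). lra. }
  exists (mkposreal _ Hd). intros w Hw.
  change (Cmod (w - z)%C < Rmin (Cmod z / 2) (eps * (Cmod z ^ 3 / 2))) in Hw.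
  change (Cmod ((/ w - / z) - (w - z) * (- / (z * z)))%C <= eps * Cmod (w - z)%C).
  pose proof (Rlt_le_trans _ _ _ Hw (Rmin_l _ _)) as Hw1.
  pose proof (Rlt_le_trans _ _ _ Hw (Rmin_r _ _)) as Hw2.
  assert (Hwm : Cmod z / 2 < Cmod w).
  { pose proof (Cmod_triangle w (- (w - z))%C) as Ht.
    replace (w + - (w - z))%C with z in Ht by ring.
    rewrite Cmod_opp in Ht. lra. }
  assert (Hw0 : (w : C) <> 0%C).
  { apply Cmod_gt_0. lra. }
  replace ((/ w - / z) - (w - z) * (- / (z * z)))%C
    with ((w - z) * ((w - z) / (w * (z * z))))%C by (field; now split).
  rewrite Cmod_mult, Rmult_comm.
  apply Rmult_le_compat_r; [apply Cmod_ge_0|].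
  rewrite Cmod_div, !Cmod_mult by now repeat apply Cmult_neq_0.
  assert (Hp : 0 < Cmod w * (Cmod z * Cmod z)).
  { repeat apply Rmult_lt_0_compat; lra. }
  apply (Rmult_le_reg_r _ _ _ Hp).
  unfold Rdiv. rewrite Rmult_assoc, Rinv_l, Rmult_1_r by lra.
  eapply Rle_trans; [apply Rlt_le, Hw2|].
  apply Rmult_le_compat_l; [apply Rlt_le, cond_pos|].
  assert (0 < Cmod z * Cmod z) by now apply Rmult_lt_0_compat.
  simpl. nra.
Qed.

(** The form of the quotient rule in which the derivative of the denominator is
    absorbed in that of the product [u f]. *)
Lemma C_derive_quotient (f u : C -> C) (z : C) :
  ex_derive f z -> ex_derive u z -> u z <> 0%C ->
  is_derive (V := C_NormedModule) (fun x => (f x / u x)%C) z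
    (2 * C_derive f z / u z
     - C_derive (fun x => (u x * f x)%C) z / (u z * u z))%C.
Proof.
  intros Hf Hu Hz.
  apply (C_derive_correct f z z) in Hf. apply (C_derive_correct u z z) in Hu.
  assert (Hp : C_derive (fun x => (u x * f x)%C) z
               = (C_derive u z * f z + u z * C_derive f z)%C).
  { now apply is_C_derive_unique, is_derive_C_mult. }
  rewrite Hp.
  pose proof (is_derive_comp (V := C_NormedModule) Cinv u z _ _
                (is_derive_Cinv (u z) Hz) (proj1 (is_derive_C_AbsRing _ _ _) Hu))
    as Hi.
  pose proof (is_derive_C_mult _ _ _ _ _ Hf Hi) as H.
  match type of H with is_derive _ _ ?d =>
    match goal with |- is_derive _ _ ?e =>
      replace e with d; [exact H|] end end.
  change (C_derive f z * / u z + f z * (C_derive u z * - / (u z * u z))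
    = 2 * C_derive f z / u z
     - (C_derive u z * f z + u z * C_derive f z) / (u z * u z))%C.
  field. exact Hz.
Qed.

(** * Evaluation functionals on the Bloch space *)

Lemma bloch_norm_ge_0 (f : Bloch) : 0 <= bloch_norm f.
Proof.
  apply Rplus_le_le_0_compat; [apply Cmod_ge_0|].
  apply bloch_seminorm_ge_0, bloch_is_bloch.
Qed.

(** The real mean value theorem on the segment from [0] to [z], applied to the real
    part of [v f] with [v] the conjugate of [f z - f 0]: the increment of this real
    part is then [|f z - f 0|^2]. *)
Lemma bloch_increment_bound (f : Bloch) (z : C) :
  unit_disk z ->
  Cmod (f z - f 0)%C * (1 - Cmod z ^ 2) <= real (bloch_seminorm f).
Proof.
  intros Hz.
  set (a := (f z - f 0)%C). set (v := Cconj a).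
  assert (Hray : forall t : R, 0 <= t <= 1 ->
            Cmod (RtoC t * z)%C <= Cmod z /\ unit_disk (RtoC t * z)%C).
  { intros t Ht. unfold unit_disk in *.
    rewrite Cmod_mult, Cmod_R, Rabs_pos_eq by lra.
    pose proof (Cmod_ge_0 z). split; nra. }
  assert (HD : forall t : R, 0 <= t <= 1 ->
            is_derive (fun s : R => Re (v * f (RtoC s * z))%C) t
              (Re (v * C_derive f (RtoC t * z) * z)%C)).
  { intros t Ht.
    destruct (C_derive_scal v f (RtoC t * z)%C) as [He Hd].
    { now apply (bloch_is_bloch f), Hray. }
    apply (is_derive_Re_ray (fun w => v * f w)%C).
    rewrite <- Hd. now apply C_derive_correct. }
  destruct (MVT_gen (fun s : R => Re (v * f (RtoC s * z))%C) 0 1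
              (fun t : R => Re (v * C_derive f (RtoC t * z) * z)%C))
    as (t & Ht & E).
  { rewrite Rmin_left, Rmax_right by lra. intros x Hx. apply HD. lra. }
  { rewrite Rmin_left, Rmax_right by lra. intros x Hx.
    apply continuity_pt_filterlim.
    apply (ex_derive_continuous (fun s : R => Re (v * f (RtoC s * z))%C)).
    eexists. now apply HD. }
  rewrite Rmin_left, Rmax_right in Ht by lra.
  destruct (Hray t Ht) as [Htz HtD].
  set (d := C_derive f (RtoC t * z)%C) in *.
  assert (E2 : Cmod a ^ 2 = Re (v * d * z)%C).
  { rewrite <- (Rmult_1_r (Re (v * d * z)%C)).
    replace 1 with (1 - 0) at 1 by ring. rewrite <- E.
    rewrite Cmult_1_l, Cmult_0_l.
    replace (Cmod a ^ 2) with (Re (v * a)%C).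
    - unfold a, Re. simpl. ring.
    - unfold v. rewrite Cmod2_alt. unfold Re, Im. destruct a as [p q]. simpl. ring. }
  assert (HR : Re (v * d * z)%C <= Cmod a * (Cmod d * Cmod z)).
  { eapply Rle_trans; [apply Rle_abs|].
    eapply Rle_trans; [apply Rmax_l|].
    eapply Rle_trans; [apply Rmax_Cmod|].
    rewrite !Cmod_mult. unfold v. rewrite Cmod_conj. lra. }
  pose proof (bloch_seminorm_ub f (bloch_is_bloch f) _ HtD) as Hs. fold d in Hs.
  pose proof (unit_disk_weight z Hz).
  pose proof (Cmod_ge_0 d). pose proof (Cmod_ge_0 z). pose proof (Cmod_ge_0 a).
  pose proof (Cmod_ge_0 (RtoC t * z)%C).
  unfold unit_disk in Hz.
  assert (Hmono : Cmod d * (1 - Cmod z ^ 2) <= real (bloch_seminorm f)).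
  { eapply Rle_trans; [|exact Hs]. rewrite Rmult_comm.
    apply Rmult_le_compat_r; [lra|].
    pose proof (pow_incr (Cmod (RtoC t * z)%C) (Cmod z) 2). lra. }
  assert (Ha : Cmod a <= Cmod d).
  { destruct (Req_dec (Cmod a) 0) as [->|Ha]; [lra|].
    apply (Rmult_le_reg_l (Cmod a)); [lra|].
    replace (Cmod a * Cmod a) with (Cmod a ^ 2) by ring.
    rewrite E2. eapply Rle_trans; [exact HR|].
    apply Rmult_le_compat_l; [assumption | nra]. }
  nra.
Qed.

Lemma bloch_evaluation_bound (f : Bloch) (z : C) :
  unit_disk z -> Cmod (f z) <= / (1 - Cmod z ^ 2) * bloch_norm f.
Proof.
  intros Hz.
  pose proof (bloch_increment_bound f z Hz) as Hi.
  pose proof (unit_disk_weight z Hz) as Hw.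
  pose proof (Cmod_le_minus_plus (f z) (f 0%C)).
  pose proof (Cmod_ge_0 (f 0%C)). pose proof (pow2_ge_0 (Cmod z)).
  apply (Rmult_le_reg_l _ _ _ Hw).
  rewrite <- Rmult_assoc, Rinv_r, Rmult_1_l by lra.
  unfold bloch_norm. nra.
Qed.

Lemma locally_unit_disk (z : C_AbsRing) : unit_disk z -> locally z unit_disk.
Proof.
  unfold unit_disk. intros Hz.
  assert (He : 0 < 1 - Cmod z) by lra.
  exists (mkposreal _ He). intros w Hw.
  change (Cmod (w - z)%C < 1 - Cmod z) in Hw.
  pose proof (Cmod_le_minus_plus w z). lra.
Qed.

Definition disk_one (z : C) : C :=
  if Rlt_dec (Cmod z) 1 then 1%C else 0%C.

Lemma disk_one_inside (z : C) : unit_disk z -> disk_one z = 1%C.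
Proof. unfold disk_one, unit_disk. now destruct (Rlt_dec (Cmod z) 1). Qed.

Lemma disk_one_outside (z : C) : ~ unit_disk z -> disk_one z = 0%C.
Proof. unfold disk_one, unit_disk. now destruct (Rlt_dec (Cmod z) 1). Qed.

Lemma is_bloch_disk_one : is_bloch disk_one.
Proof.
  assert (H : forall z, unit_disk z ->
            is_derive (V := C_NormedModule) disk_one z (RtoC 0)).
  { intros z Hz.
    apply (is_derive_ext_loc (V := C_NormedModule) (fun _ : C => RtoC 1)).
    - apply (filter_imp unit_disk); [|now apply locally_unit_disk].
      intros w Hw. now rewrite disk_one_inside.
    - apply (@is_derive_const C_AbsRing C_NormedModule). }
  apply (is_bloch_intro _ 0).
  - intros z Hz. eexists. now apply H.
  - intros z Hz. rewrite (is_C_derive_unique _ _ _ (H z Hz)), Cmod_0. lra.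
Qed.

Definition bloch_one : Bloch := mkBloch disk_one disk_one_outside is_bloch_disk_one.

(** Let [l] be the norm of the evaluation at [z]; it is finite, and it is positive
    because of the constant [1].  On the unit ball, [|k| |f z| = |T f z| <= l M];
    taking the supremum gives [|k| l <= l M]. *)
Lemma evaluation_eigenvalue_bound (T : Bloch -> Bloch) (M : R) (z k : C) :
  0 < M -> (forall f, bloch_norm (T f) <= M * bloch_norm f) ->
  unit_disk z -> (forall f : Bloch, T f z = (k * f z)%C) ->
  Cmod k <= M.
Proof.
  intros HM HT Hz Hk.
  set (E := fun x : R => exists f : Bloch, bloch_norm f <= 1 /\ x = Cmod (f z)).
  pose proof (unit_disk_weight z Hz) as Hw.
  pose proof (Rinv_0_lt_compat _ Hw) as Hw'.
  assert (Hnormalize : forall (f : Bloch) (a : R), 0 < a -> bloch_norm f <= a ->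
            E (/ a * Cmod (f z))).
  { intros f a Ha Hf. pose proof (Rinv_0_lt_compat _ Ha) as Ha'.
    assert (Hc : Cmod (RtoC (/ a)) = / a).
    { rewrite Cmod_R. apply Rabs_pos_eq. lra. }
    exists (bloch_scal (RtoC (/ a)) f). split.
    - eapply Rle_trans; [apply (bloch_norm_scal (RtoC (/ a)) f)|].
      rewrite Hc. apply (Rmult_le_reg_l a); [exact Ha|].
      rewrite <- Rmult_assoc, Rinv_r, Rmult_1_l by lra. lra.
    - simpl. now rewrite Cmod_mult, Hc. }
  destruct (completeness E) as [l [Hub Hlub]].
  { exists (/ (1 - Cmod z ^ 2)). intros x (f & Hf & ->).
    pose proof (bloch_evaluation_bound f z Hz). nra. }
  { exists (Cmod (bloch_zero z)). exists bloch_zero. split; [|reflexivity].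
    rewrite bloch_norm_zero. lra. }
  assert (Hl : 0 < l).
  { pose proof (bloch_norm_ge_0 bloch_one) as H0.
    assert (H1 : E (/ (bloch_norm bloch_one + 1) * Cmod (bloch_one z))).
    { apply Hnormalize; lra. }
    apply Hub in H1. simpl in H1. rewrite disk_one_inside, Cmod_1 in H1 by exact Hz.
    assert (0 < / (bloch_norm bloch_one + 1)) by (apply Rinv_0_lt_compat; lra).
    lra. }
  destruct (Rle_lt_dec (Cmod k) M) as [|Hlt]; [assumption|exfalso].
  assert (Hk0 : 0 < Cmod k) by lra.
  assert (Hball : l <= l * M / Cmod k).
  { apply Hlub. intros x (f & Hf & ->).
    assert (HE : E (/ M * Cmod (T f z))).
    { apply Hnormalize; [exact HM|]. pose proof (HT f). nra. }
    apply Hub in HE. rewrite Hk, Cmod_mult in HE.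
    apply (Rmult_le_reg_l (/ M * Cmod k)).
    - apply Rmult_lt_0_compat; [now apply Rinv_0_lt_compat | exact Hk0].
    - replace (/ M * Cmod k * (l * M / Cmod k)) with l by (field; lra). lra. }
  apply (Rmult_le_compat_r (Cmod k)) in Hball; [|lra].
  replace (l * M / Cmod k * Cmod k) with (l * M) in Hball by (field; lra).
  nra.
Qed.

(** * Invertibility of multiplication operators *)

(** [g] stands for [u f], so that the formula of [C_derive_quotient], with [|u| >= c],
    only involves the Bloch norms of two Bloch functions. *)
Lemma bloch_quotient (u : C -> C) (c : R) (f g : Bloch) :
  analytic_on_disk u -> 0 < c -> (forall z, unit_disk z -> c <= Cmod (u z)) ->
  (forall z, g z = (u z * f z)%C) ->
  is_bloch (fun z => (f z / u z)%C) /\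
  real (bloch_seminorm (fun z => (f z / u z)%C))
    <= 2 / c * bloch_norm f + / c ^ 2 * bloch_norm g.
Proof.
  intros Hu Hc Hlow Hg.
  assert (Hd : forall z, unit_disk z ->
    is_derive (V := C_NormedModule) (fun x => (f x / u x)%C) z
      (2 * C_derive f z / u z - C_derive g z / (u z * u z))%C).
  { intros z Hz.
    replace (C_derive g z) with (C_derive (fun x => (u x * f x)%C) z).
    - apply C_derive_quotient; [now apply (bloch_is_bloch f) | now apply Hu |].
      apply Cmod_gt_0. pose proof (Hlow z Hz). lra.
    - f_equal. apply FunctionalExtensionality.functional_extensionality.
      intros x. now rewrite Hg. }
  apply is_bloch_intro.
  - intros z Hz. eexists. now apply Hd.
  - intros z Hz.
    replace (C_derive (fun x => (f x / u x)%C) z)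
      with (2 * C_derive f z / u z - C_derive g z / (u z * u z))%C
      by now symmetry; apply is_C_derive_unique, Hd.
    pose proof (Hlow z Hz) as Hl.
    assert (Hu0 : u z <> 0%C) by (apply Cmod_gt_0; lra).
    pose proof (unit_disk_weight z Hz) as Hw.
    pose proof (bloch_seminorm_ub f (bloch_is_bloch f) z Hz) as Hf.
    pose proof (bloch_seminorm_ub g (bloch_is_bloch g) z Hz) as Hg'.
    assert (Hi : / Cmod (u z) <= / c) by now apply Rinv_le_contravar.
    assert (Hi0 : 0 < / Cmod (u z)) by (apply Rinv_0_lt_compat; lra).
    assert (Ht : Cmod (2 * C_derive f z / u z - C_derive g z / (u z * u z))%C
      <= 2 * Cmod (C_derive f z) * / c + Cmod (C_derive g z) * (/ c * / c)).
    { unfold Cminus. eapply Rle_trans; [apply Cmod_triangle|].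
      rewrite Cmod_opp, !Cmod_div, !Cmod_mult, Cmod_R, Rabs_pos_eq
        by (try lra; try exact Hu0; now apply Cmult_neq_0).
      unfold Rdiv. rewrite Rinv_mult.
      pose proof (Cmod_ge_0 (C_derive f z)). pose proof (Cmod_ge_0 (C_derive g z)).
      apply Rplus_le_compat; apply Rmult_le_compat_l; try lra.
      apply Rmult_le_compat; lra. }
    unfold bloch_norm.
    pose proof (Cmod_ge_0 (f 0%C)). pose proof (Cmod_ge_0 (g 0%C)).
    assert (Hc' : 0 < / c) by now apply Rinv_0_lt_compat.
    assert (Hc2 : 0 < / c * / c) by now apply Rmult_lt_0_compat.
    replace (/ c ^ 2) with (/ c * / c) by (field; lra).
    eapply Rle_trans; [apply Rmult_le_compat_l; [lra | exact Ht]|].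
    replace ((1 - Cmod z ^ 2)
      * (2 * Cmod (C_derive f z) * / c + Cmod (C_derive g z) * (/ c * / c)))
      with (2 / c * ((1 - Cmod z ^ 2) * Cmod (C_derive f z))
            + / c * / c * ((1 - Cmod z ^ 2) * Cmod (C_derive g z))) by (field; lra).
    apply Rplus_le_compat; apply Rmult_le_compat_l; try lra.
Qed.

Lemma mult_invertible_iff_bounded_below
    (u : C -> C) (T : Bloch -> Bloch) (M : R) :
  analytic_on_disk u -> (forall (f : Bloch) z, T f z = (u z * f z)%C) ->
  (forall f, bloch_norm (T f) <= M * bloch_norm f) ->
  invertible_op T <->
  exists c, 0 < c /\ forall z, unit_disk z -> c <= Cmod (u z).
Proof.
  intros Hu HT HM. split.
  - intros (S & HS & HST & HTS).
    destruct (linear_norm S HS) as (N & HN & HSN).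
    exists (/ N). split; [now apply Rinv_0_lt_compat|]. intros z Hz.
    assert (Hu0 : u z <> 0%C).
    { intros E. pose proof (HT (S bloch_one) z) as H.
      rewrite HTS, E, Cmult_0_l in H. simpl in H.
      rewrite disk_one_inside in H by exact Hz. injection H. lra. }
    assert (Hk : Cmod (/ u z) <= N).
    { apply (evaluation_eigenvalue_bound S N z); [exact HN | exact HSN | exact Hz |].
      intros f. rewrite <- (HTS f) at 2. rewrite HT. field. exact Hu0. }
    pose proof (proj1 (Cmod_gt_0 _) Hu0).
    rewrite Cmod_inv in Hk by exact Hu0.
    rewrite <- (Rinv_inv (Cmod (u z))).
    apply Rinv_le_contravar; [now apply Rinv_0_lt_compat | exact Hk].
  - intros (c & Hc & Hlow).
    pose proof (fun f => bloch_quotient u c f (T f) Hu Hc Hlow (HT f)) as HQ.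
    assert (Hout : forall (f : Bloch) z, ~ unit_disk z -> (f z / u z)%C = 0%C).
    { intros f z Hz. rewrite (bloch_outside f z Hz). apply Cmult_0_l. }
    assert (Hne : forall z, unit_disk z -> u z <> 0%C).
    { intros z Hz. apply Cmod_gt_0. pose proof (Hlow z Hz). lra. }
    assert (Hc' : 0 < / c) by now apply Rinv_0_lt_compat.
    exists (fun f : Bloch => mkBloch (fun z => (f z / u z)%C) (Hout f) (proj1 (HQ f))).
    split; [|split].
    + split.
      * intros f g. apply Bloch_eq. intros z. simpl. unfold Cdiv. ring.
      * intros k f. apply Bloch_eq. intros z. simpl. unfold Cdiv. ring.
      (* [2 / c] and [/ c ^ 2 * M] bound the seminorm, a further [1 / c] the value
         at [0]; the rest makes the constant positive whatever the sign of [M]. *)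
      * exists (3 / c + / c ^ 2 * Rabs M + 1).
        assert (Hc2 : 0 < / c ^ 2) by (apply Rinv_0_lt_compat, pow_lt, Hc).
        pose proof (Rabs_pos M). split; [unfold Rdiv; nra|]. intros f.
        change (Cmod (f 0 / u 0)%C
                + real (bloch_seminorm (fun z => (f z / u z)%C))
                <= (3 / c + / c ^ 2 * Rabs M + 1) * bloch_norm f).
        pose proof (proj2 (HQ f)) as Hs.
        pose proof (bloch_norm_ge_0 f).
        assert (Hf0 : Cmod (f 0 / u 0)%C <= / c * bloch_norm f).
        { rewrite Cmod_div by now apply Hne, unit_disk_0.
          pose proof (Hlow _ unit_disk_0).
          unfold Rdiv. rewrite Rmult_comm. apply Rmult_le_compat.
          - apply Rlt_le, Rinv_0_lt_compat. lra.
          - apply Cmod_ge_0.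
          - now apply Rinv_le_contravar.
          - unfold bloch_norm.
            pose proof (bloch_seminorm_ge_0 f (bloch_is_bloch f)). lra. }
        assert (HTM : / c ^ 2 * bloch_norm (T f)
                      <= / c ^ 2 * (Rabs M * bloch_norm f)).
        { apply Rmult_le_compat_l; [lra|]. eapply Rle_trans; [apply HM|].
          apply Rmult_le_compat_r; [assumption | apply Rle_abs]. }
        unfold Rdiv in *. nra.
    + intros f. apply Bloch_eq. intros z. simpl. rewrite HT.
      destruct (classic (unit_disk z)) as [Hz|Hz].
      * field. now apply Hne.
      * rewrite (bloch_outside f z Hz). unfold Cdiv. ring.
    + intros f. apply Bloch_eq. intros z. rewrite HT. simpl.
      destruct (classic (unit_disk z)) as [Hz|Hz].
      * field. now apply Hne.
      * rewrite (bloch_outside f z Hz). unfold Cdiv. ring.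
Qed.

(** * The spectrum *)

(** The lower bound is stated for [psi - lambda], the symbol of the operator whose
    invertibility decides whether [lambda] is in the spectrum. *)
Lemma closure_disk_image_iff (psi : C -> C) (lambda : C) :
  closure (disk_image psi) lambda <->
  ~ exists c, 0 < c /\ forall z, unit_disk z -> c <= Cmod (psi z - lambda)%C.
Proof.
  split.
  - intros Hcl (c & Hc & Hlow).
    destruct (Hcl (fun w => Cmod (w - lambda)%C < c)) as (w & Hw & z & Hz & <-).
    + apply locally_C. now exists (mkposreal c Hc).
    + pose proof (Hlow z Hz). lra.
  - intros Hn P HP. apply locally_C in HP. destruct HP as [eps Heps].
    apply NNPP. intros HnP. apply Hn.
    exists eps. split; [apply cond_pos|]. intros z Hz.
    destruct (Rle_lt_dec eps (Cmod (psi z - lambda)%C)) as [|Hlt]; [assumption|].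
    exfalso. apply HnP. exists (psi z). split; [now apply Heps | now exists z].
Qed.

Theorem theorem4p1 (psi : C -> C)
  (psi_analytic : analytic_on_disk psi)
  (psi_mult : bloch_multiplier psi)
  (Mpsi_bounded : is_linear (mult_op psi psi_mult)) :
  forall lambda : C,
    spectrum (mult_op psi psi_mult) lambda <-> closure (disk_image psi) lambda.
Proof.
  intros lambda.
  destruct (linear_norm _ Mpsi_bounded) as (M & _ & HM).
  rewrite closure_disk_image_iff. unfold spectrum.
  rewrite (mult_invertible_iff_bounded_below (fun z => psi z - lambda)%C _
             (M + Cmod lambda)); [reflexivity | | |].
  - intros z Hz.
    apply (C_derive_plus psi (fun _ => - lambda)%C); [now apply psi_analytic|].
    eexists. apply (@is_derive_const C_AbsRing C_NormedModule).
  - intros f z. simpl. ring.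
  - intros f. unfold minus.
    eapply Rle_trans; [apply bloch_norm_plus|].
    rewrite Rmult_plus_distr_r. apply Rplus_le_compat; [apply HM|].
    eapply Rle_trans; [apply bloch_norm_opp | apply bloch_norm_scal].
Qed.
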